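(* Let $G$ be a finite group and $H$ a subgroup such that the interval $[H,G]$ is boolean of rank $n<7$. Then $[H,G]$ is linearly primitive.
   Context: For a subgroup $H$ of a finite group $G$, $[H,G]$ denotes the lattice of all subgroups $K$ with $H \subseteq K \subseteq G$, ordered by inclusion, with $K_1 \vee K_2 = \langle K_1, K_2\rangle$ and $K_1 \wedge K_2 = K_1 \cap K_2$. The interval is boolean of rank $n$ if this lattice is isomorphic to the lattice $B_n$ of subsets of $\{1,\dots,n\}$. For a representation $V$ of a group $G$ and a subgroup $H$, $V^H = \{v\in V \mid hv=v \ \forall h \in H\}$; for a subspace $X \subseteq V$, $G_{(X)} = \{g\in G \mid gx = x \ \forall x\in X\}$. An interval $[H,G]$ is called linearly primitive if there is an irreducible complex representation $V$ of $G$ such that $G_{(V^H)} = H$. *)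

(* Defs.v *)
From HB Require Import structures.
From mathcomp Require Import all_boot all_order all_algebra all_fingroup.
From mathcomp Require Import mxrepresentation reals complex.

Set Implicit Arguments.
Unset Strict Implicit.
Unset Printing Implicit Defensive.

Import GroupScope.

Definition subgroup_interval (gT : finGroupType) (H G : {group gT}) :
    {set {group gT}} :=
  [set K : {group gT} | (H \subset K) && (K \subset G)].

Definition boolean_interval (gT : finGroupType) (H G : {group gT}) (n : nat) :
    Prop :=
  exists f : {group gT} -> {set 'I_n},
    [/\ {in subgroup_interval H G &, injective f},
        f @: subgroup_interval H G = [set: {set 'I_n}],
        forall K1 K2 : {group gT},
          K1 \in subgroup_interval H G -> K2 \in subgroup_interval H G ->
          f (K1 <*> K2)%G = f K1 :|: f K2 &
        forall K1 K2 : {group gT},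
          K1 \in subgroup_interval H G -> K2 \in subgroup_interval H G ->
          f (K1 :&: K2)%G = f K1 :&: f K2].

(* [mxrepresentation] lets rG x act on row vectors by v |-> v *m rG x, a right
   action; v |-> v *m rG x^-1 is the corresponding left action, and it has the
   same fixed vectors, pointwise stabilisers and invariant subspaces. The row
   space of [rfix_mx rG H] is V^H, and [rstab rG U] is the set of the x in G
   that fix every vector of the row space of U. [mx_irreducible] excludes the
   zero representation. *)
Definition linearly_primitive (R : realType) (gT : finGroupType)
    (H G : {group gT}) : Prop :=
  exists (m : nat) (rG : mx_representation R[i] G m),
    mx_irreducible rG /\ rstab rG (rfix_mx rG H) = H :> {set gT}.

(* Main.v *)
Require Import Defs.
From mathcomp Require Import all_boot all_order all_algebra all_fingroup.
From mathcomp Require Import pgroup mxrepresentation reals complex.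

(** Linear primitivity climbs the interval one coatom at a time. Let [M] be a
coatom of the boolean interval [[H, G]] and [K] the complementary atom. Suppose
that [W] is an irreducible representation of [M] with [W^H] nonzero and
[M_(W^H) = H]. Every irreducible constituent [V] of the
representation induced from [W] to [G] contains a copy of [W], so
[G_(V^H) :&: M] lies in [M_(W^H) = H]; hence [G_(V^H)] is [H] or [K], and one
only has to find a constituent where [K] moves some vector of [V^H]. A nonzero
[w] in [W^H] gives a vector of the induced representation supported on the
coset [M]: it is fixed by [H], but an element [k] of [K] outside [M] moves its
support off [M]. Since the induced representation is a sum of irreducible ones,
[k] also moves the component of this vector in some constituent [V], and that
[V] has [G_(V^H) = H].

The induced representation is realised inside the regular representation of
[G]: a linear functional [c] on [W] yields the matrix coefficients
[x |-> c (w x^-1)], extended by zero outside [M] ([coef_mx]). The step from [M]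
to [G] is [fixer_witness_lift]; the lattice part of the argument, which supplies
[M] and [k], is in the induction [boolean_fixer_witness]. *)

Set Implicit Arguments.
Unset Strict Implicit.
Unset Printing Implicit Defensive.

Import GroupScope GRing.Theory Num.Theory.
Local Open Scope ring_scope.

(** * Homomorphisms onto simple modules *)

(** The projections onto the simple summands of a semisimple module vanish
together only on the zero vector. *)
Lemma simple_hom_separates (F : decFieldType) (gT : finGroupType)
    (G : {group gT}) (n : nat) (rG : mx_representation F G n)
    (m : nat) (d : 'M[F]_(m, n)) :
    mx_completely_reducible rG 1%:M -> d != 0 ->
  exists (U p : 'M[F]_n), [/\ mxsimple rG U,
    forall x, x \in G -> rG x *m p = p *m rG x, (p <= U)%MS & d *m p != 0].
Proof.
move=> redG nz_d.
have [I U /= simU defV dxU] := dec_mx_reducible_semisimple (mxmodule1 rG) redG.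
have modU i : mxmodule rG (U i) by case: (simU i).
pose U' i := (\sum_(j | j != i) U j)%MS; pose p i := proj_mx (U i) (U' i).
have dxUU' i : (U i :&: U' i = 0)%MS by apply: (mxdirect_sumsP dxU).
have /sub_sumsmxP[u def_d]: (d <= \sum_i U i)%MS by rewrite defV submx1.
have dp i : d *m p i = u i *m U i.
  rewrite def_d (bigD1 i) //= mulmxDl proj_mx_id ?submxMl //.
  rewrite proj_mx_0 ?addr0 //; apply: summx_sub => j ji.
  by rewrite (sumsmx_sup j) ?submxMl.
have [i nz_dp | no_i] := pickP (fun i => d *m p i != 0); last first.
  case/eqP: nz_d; rewrite def_d big1 // => i _.
  by rewrite -dp; apply/eqP; rewrite -[_ == _]negbK no_i.
exists (U i), (p i); split=> // [x Gx|]; last first.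
  by rewrite -[p i]mul1mx proj_mx_sub.
have modU' : mxmodule rG (U' i) by apply: sumsmx_module.
have /hom_mxP hom_p: (1%:M <= dom_hom_mx rG (p i))%MS.
  apply: submx_trans (proj_mx_hom (dxUU' i) (modU i) modU').
  by rewrite -defV (bigD1 i).
by have := hom_p x Gx; rewrite !mul1mx.
Qed.

(** * Matrix coefficients extended by zero *)

Lemma mulmx_regular (F : fieldType) (gT : finGroupType) (G : {group gT})
    (m : nat) (A : 'M[F]_(m, #|G|)) (x : gT) i j : x \in G ->
  (A *m regular_repr F G x) i j = A i (gring_index G (enum_val j * x^-1)%g).
Proof.
move=> Gx; have Gj := enum_valP j.
rewrite mxE (bigD1 (gring_index G (enum_val j * x^-1)%g)) //=.
rewrite !mxE gring_indexK ?groupM ?groupV // mulgKV gring_valK !eqxx mulr1.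
rewrite big1 ?addr0 // => l ne_l; rewrite !mxE eqxx /=.
case: eqP => [def_j|]; last by rewrite mulr0.
case/eqP: ne_l; rewrite def_j gring_indexK ?groupM ?enum_valP //.
by rewrite mulgK gring_valK.
Qed.

(** The inverse is what makes [w |-> (x |-> c (w x^-1))] equivariant for right
translation. *)
Definition coef_mx (F : fieldType) (gT : finGroupType) (G M : {group gT})
    (m : nat) (rM : mx_representation F M m) (c : 'cV[F]_m) : 'M[F]_(m, #|G|) :=
  \matrix_(i, j) if enum_val j \in M then (rM (enum_val j)^-1%g *m c) i 0 else 0.

Lemma mul_coef_mx (F : fieldType) (gT : finGroupType) (G M : {group gT})
    (m : nat) (rM : mx_representation F M m) (c : 'cV[F]_m)
    n (A : 'M[F]_(n, m)) i j :
  (A *m coef_mx G rM c) i j =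
    if enum_val j \in M then (A *m rM (enum_val j)^-1%g *m c) i 0 else 0.
Proof.
rewrite mxE; case: ifP => Mj; last by rewrite big1 // => l _; rewrite mxE Mj mulr0.
by rewrite -mulmxA mxE; apply: eq_bigr => l _; rewrite [in LHS]mxE Mj.
Qed.

Lemma coef_mx_hom (F : fieldType) (gT : finGroupType) (G M : {group gT})
    (m : nat) (rM : mx_representation F M m) (c : 'cV[F]_m)
    x : M \subset G -> x \in M ->
  rM x *m coef_mx G rM c = coef_mx G rM c *m regular_repr F G x.
Proof.
move=> sMG Mx; apply/matrixP=> i j; have Gx := subsetP sMG x Mx.
rewrite mulmx_regular // mul_coef_mx [in RHS]mxE.
rewrite gring_indexK; last by rewrite groupM ?groupV ?enum_valP.
rewrite (groupMr _ (groupVr Mx)); case: ifP => // Mj.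
by rewrite -repr_mxM ?groupV // invMg invgK.
Qed.

(** Translating by an element outside [M] moves the support of the coefficient
vector off the identity element, where its value is [w *m c]. *)
Lemma coef_mx_moved (F : fieldType) (gT : finGroupType) (G M : {group gT})
    (m : nat) (rM : mx_representation F M m) (c : 'cV[F]_m)
    (w : 'rV[F]_m) k : k \in G -> k \notin M ->
  w *m c != 0 ->
  w *m coef_mx G rM c *m regular_repr F G k - w *m coef_mx G rM c != 0.
Proof.
move=> Gk notMk; apply: contraNneq => eq0.
have := congr1 (fun A : 'rV_#|G| => A 0 (gring_index G 1%g)) eq0.
rewrite [in LHS]mxE mulmx_regular // [X in _ + X]mxE !mul_coef_mx [in RHS]mxE.
rewrite !gring_indexK ?mul1g ?groupV ?group1 // (negPf notMk).
rewrite invg1 repr_mx1 mulmx1 sub0r => /eqP; rewrite oppr_eq0 => /eqP wc0.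
by apply/eqP/matrixP=> i j; rewrite !ord1 wc0 mxE.
Qed.

(** * Climbing from a subgroup to the group *)

(** The nonzero fixed vector matters when [H = G]: it excludes the nontrivial
irreducible representations, from which the induction could not start, since
the step from [M] to [G] begins with a nonzero vector of [W^H]. *)
Definition fixer_witness (F : fieldType) (gT : finGroupType)
    (H G : {group gT}) : Prop :=
  exists (m : nat) (rG : mx_representation F G m),
    [/\ mx_irreducible rG, rstab rG (rfix_mx rG H) = H :> {set gT}
      & rfix_mx rG H != 0].

Lemma fixer_witness_refl (F : fieldType) (gT : finGroupType) (G : {group gT}) :
  fixer_witness F G G.
Proof.
have triv_repr : mx_repr G (fun _ : gT => 1%:M : 'M[F]_1).
  by split=> // x y _ _; rewrite mulmx1.
pose rG := MxRepresentation triv_repr.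
have fix1 : (1%:M <= rfix_mx rG G)%MS.
  by apply/rfix_mxP=> x Gx; rewrite mul1mx.
exists 1%N, rG; split; first exact/mx_abs_irrW/linear_mx_abs_irr.
- apply/eqP; rewrite eqEsubset rstab_sub; apply/subsetP=> x Gx.
  by rewrite inE Gx mulmx1 eqxx.
- apply: contraTneq fix1 => ->.
  by rewrite submx0 -mxrank_eq0 mxrank1.
Qed.

(** The injective half of Schur's lemma. The kernel is a submodule for any
matrices [a x], which lets the target carry a representation of a larger group
than [M]. *)
Lemma irr_hom_inj (F : fieldType) (gT : finGroupType) (M : {group gT})
    (m n : nat) (rM : mx_representation F M m) (f : 'M[F]_(m, n))
    (a : gT -> 'M[F]_n) :
    mx_irreducible rM -> (forall x, x \in M -> rM x *m f = f *m a x) ->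
  f != 0 -> row_free f.
Proof.
case/mx_irrP=> _ irrM hom_f; rewrite -kermx_eq0; apply: contraNT => nz_ker.
have mod_ker : mxmodule rM (kermx f).
  apply/mxmoduleP=> x Mx; apply/sub_kermxP.
  by rewrite -mulmxA hom_f // mulmxA mulmx_ker mul0mx.
rewrite -[f]mul1mx; apply/eqP/sub_kermxP.
by rewrite sub1mx irrM.
Qed.

Lemma val_rfix_submod (F : fieldType) (gT : finGroupType) (H G : {group gT})
    (n : nat) (rG : mx_representation F G n) (U : 'M[F]_n)
    (modU : mxmodule rG U) :
    H \subset G ->
  (val_submod (rfix_mx (submod_repr modU) H) :=: U :&: rfix_mx rG H)%MS.
Proof.
move=> sHG; apply: eqmx_trans (eqmxMr _ (rfix_submod modU sHG)) _.
by rewrite -[X in (X :=: _)%MS]/(val_submod _) in_submodK ?capmxSl.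
Qed.

(** The step from [M] to [G]: the witness for [G] is a simple submodule of the
regular module, the image of the module induced from the witness for [M] under
a projection that does not kill the displacement of [w] by [k]. The resulting
homomorphism [f] embeds the witness for [M] in it. The hypothesis on [T] is what
remains of complementation: [T] will be the stabiliser [G_(V^H)]. *)
Lemma fixer_witness_lift (F : decFieldType) (gT : finGroupType)
    (H M G : {group gT}) (k : gT) :
    [pchar F]^'.-group G -> H \subset M -> M \subset G ->
    k \in G -> k \notin M ->
    (forall T : {group gT}, H \subset T -> T \subset G ->
       T :&: M = H -> T = H :> {set gT} \/ k \in T) ->
  fixer_witness F H M -> fixer_witness F H G.
Proof.
move=> charG sHM sMG Gk notMk minH [m [rM [irrM stabM nz_fixM]]].
have sHG := subset_trans sHM sMG; set aG := regular_repr F G.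
have [w fix_w nz_w] := rowV0Pn nz_fixM.
have [j nz_wj]: exists j, w 0 j != 0 by apply/rV0Pn.
pose c : 'cV[F]_m := delta_mx j 0; pose phi := coef_mx G rM c.
have nz_wc : w *m c != 0.
  apply: contraNneq nz_wj => wc0.
  have := congr1 (fun A : 'M_1 => A 0 0) wc0.
  by rewrite -colE !mxE => ->.
have := coef_mx_moved rM Gk notMk nz_wc; rewrite -/aG -/phi => nz_d.
have [U [p [simU hom_p sub_p nz_dp]]] :=
  simple_hom_separates (mx_Maschke_pchar aG charG) nz_d.
have modU := mxsimple_module simU; pose f := phi *m p.
have hom_f x : x \in M -> rM x *m f = f *m aG x.
  move=> Mx; rewrite /f mulmxA coef_mx_hom // -!mulmxA hom_p //.
  exact: (subsetP sMG).
have moved : w *m f *m aG k != w *m f.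
  apply: contraNneq nz_dp => fixed; apply/eqP.
  have wfE : w *m phi *m p = w *m f by rewrite mulmxA.
  rewrite mulmxBl -[w *m phi *m aG k *m p]mulmxA hom_p // mulmxA wfE.
  by rewrite fixed subrr.
have nz_wf : w *m f != 0.
  by apply: contraNneq moved => ->; rewrite mul0mx.
have inj_f : row_free f.
  apply: irr_hom_inj irrM hom_f _.
  by apply: contraNneq nz_wf => ->; rewrite mulmx0.
have fix_f : (rfix_mx rM H *m f <= U :&: rfix_mx aG H)%MS.
  rewrite sub_capmx mulmxA mulmx_sub //; apply/rfix_mxP=> x Hx.
  have Mx := subsetP sHM x Hx.
  by rewrite -mulmxA -[phi *m p]/f -mulmxA -hom_f // mulmxA rfix_mx_id.
have fix_wf : (w *m f <= U :&: rfix_mx aG H)%MS.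
  by apply: submx_trans fix_f; apply: submxMr.
have defV := val_rfix_submod modU sHG.
exists (\rank U), (submod_repr modU); split; first exact/submod_mx_irr.
- rewrite rstab_submod (eqmx_rstab _ defV).
  set T := rstab aG _.
  have sHT : H \subset T.
    apply/subsetP=> x Hx; rewrite inE (subsetP sHG) //=.
    by apply/eqP; move: x Hx; apply/rfix_mxP/capmxSr.
  (* An element of [M] fixing the [f]-image of the old fixed vectors fixes these
     vectors themselves, because [f] is injective. *)
  have TM : T :&: M = H.
    apply/eqP; rewrite eqEsubset subsetI sHT sHM !andbT.
    apply/subsetP=> x /setIP[Tx Mx]; rewrite -stabM inE Mx /=.
    have /setIdP[_ /eqP fix_x] := subsetP (rstabS aG fix_f) x Tx.
    by apply/eqP/(row_free_inj inj_f); rewrite -mulmxA hom_f // mulmxA.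
  have [//| Tk] := minH [group of T] sHT (rstab_sub _ _) TM.
  have /setIdP[_ fix_k] := subsetP (rstabS aG fix_wf) k Tk.
  by rewrite fix_k in moved.
- rewrite -val_submod_eq0 (eqmx_eq0 defV).
  by apply: contraNneq nz_wf => z; rewrite z submx0 in fix_wf.
Qed.

(** * Boolean intervals *)

(** Induction on the rank of [L] in the interval: removing a point [i] from the
subset of [L] gives a coatom [M] of [[H, L]] whose complement is the atom
[K] attached to [i]. A subgroup [T] with [T :&: M = H] has a subset contained in
[[set i]], so it is [H] or [K]; an element of [K] outside [M] tells these two
apart. *)
Lemma boolean_fixer_witness (F : decFieldType) (gT : finGroupType)
    (H G : {group gT}) (n : nat) :
    [pchar F]^'.-group G -> boolean_interval H G n ->
  forall L : {group gT}, L \in subgroup_interval H G -> fixer_witness F H L.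
Proof.
move=> charG [f [f_inj f_onto _ f_meet]].
set S := subgroup_interval H G in f_inj f_onto f_meet *.
have f_surj A : exists2 K : {group gT}, K \in S & f K = A.
  by have /imsetP[K SK ->]: A \in f @: S; [rewrite f_onto inE | exists K].
have f_le (K L : {group gT}) : K \in S -> L \in S ->
    (K \subset L) = (f K \subset f L).
  move=> SK SL; have SI : (K :&: L)%G \in S.
    move: SK SL; rewrite !inE subsetI => /andP[-> sKG] /andP[-> _] /=.
    by rewrite subIset ?sKG.
  apply/idP/idP=> [/setIidPl sKL | /setIidPl sKL]; apply/setIidPl.
    by rewrite -f_meet //; congr (f _); apply/val_inj.
  by have /f_inj := etrans (f_meet _ _ SK SL) sKL => /(_ SI SK) /(congr1 val).
move=> L; have [r] := ubnP #|f L|; elim: r => // r IHr in L * => ltLr SL.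
have [sHL sLG] : H \subset L /\ L \subset G by move: SL; rewrite inE => /andP[].
have SH : H \in S by rewrite inE subxx (subset_trans sHL).
have fH : f H = set0.
  have [K SK fK] := f_surj set0; apply/eqP; rewrite -subset0 -fK -f_le //.
  by move: SK; rewrite inE => /andP[].
have [fL | [i Li]] := set_0Vmem (f L).
  by rewrite (f_inj L H) ?fL //; apply: fixer_witness_refl.
have [M SM fM] := f_surj (f L :\ i); have [K SK fK] := f_surj [set i].
have sHM : H \subset M by move: SM; rewrite inE => /andP[].
have sML : M \subset L by rewrite f_le // fM subsetDl.
have sKL : K \subset L by rewrite f_le // fK sub1set.
have /subsetPn[k Kk notMk] : ~~ (K \subset M).
  by rewrite f_le // fK fM sub1set !inE eqxx.
apply: (fixer_witness_lift (k := k) _ sHM sML _ notMk).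
- exact: pgroupS charG.
- exact: (subsetP sKL).
- move=> T sHT sTL TM; have ST : T \in S by rewrite inE sHT (subset_trans sTL).
  have [Ti | notTi] := boolP (i \in f T).
    by right; apply: (subsetP _ k Kk); rewrite f_le // fK sub1set.
  left; congr (_ : {set gT}); apply: (congr1 val (f_inj T H ST SH _)).
  have fTM : f T :&: f M = set0.
    by rewrite -f_meet // -fH; congr (f _); apply/val_inj.
  rewrite fH -fTM; apply/esym/setIidPl; rewrite fM subsetD1 notTi andbT.
  by rewrite -f_le.
- apply: IHr => //; rewrite fM.
  by move: ltLr; rewrite (cardsD1 i) Li.
Qed.

Theorem theorem4p12 (R : realType) (gT : finGroupType) (G H : {group gT})
    (n : nat) (sHG : H \subset G) (hn : (n < 7)%N)
    (hbool : boolean_interval H G n) :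
  linearly_primitive R H G.
Proof.
have charG : [pchar R[i]]^'.-group G.
  by apply: sub_in_pnat (pnat_pi _) => // p _ _; rewrite inE /= pchar_num.
have SG : G \in subgroup_interval H G by rewrite inE sHG subxx.
have [m [rG [irrG stabG _]]] := boolean_fixer_witness charG hbool SG.
by exists m, rG.
Qed.
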